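(* Let $D$ be a graded digraph on $n$ vertices with maximum degree $\Delta$. Then \[ \vec r(D) \leq 10^9 \Delta^3 2^{4\Delta} n. \] More precisely, if $D$ has maximum in-degree $\Delta^-$ and maximum out-degree $\Delta^+$, then \[ \vec r(D) \leq 10^9 \Delta^+ (\Delta^-)^2 2^{4\Delta^-} n. \]
   Context: A tournament is an orientation of a complete graph. For an acyclic digraph $G$, the oriented Ramsey number $\vec r(G)$ is the smallest integer $N$ such that every tournament on $N$ vertices contains a copy of $G$ (as a subgraph, respecting orientations). A digraph $G$ is graded if its vertex set can be partitioned as $V(G)=V_1\cup\dots\cup V_H$ so that every edge is directed from $V_i$ to $V_{i+1}$ for some $i\in[H-1]$ (such digraphs are acyclic). The maximum degree of a digraph is the maximum degree of its underlying undirected graph.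
   Formalization: The digraph D is assumed to have at least one edge (Δ ≥ 1); for an edgeless D on n ≥ 1 vertices the oriented Ramsey number is n while both stated bounds are 0, so the claim fails there. *)

(* Defs.v *)
(* A digraph on the finite vertex type V is its edge relation D : rel V, with
   D x y meaning that there is an edge x -> y.  Loops and 2-cycles need not be
   excluded separately: a graded digraph has none. *)
From mathcomp Require Import all_boot.

Set Implicit Arguments.
Unset Strict Implicit.
Unset Printing Implicit Defensive.

Definition tournament (W : finType) (T : rel W) : Prop :=
  irreflexive T /\ forall x y : W, x != y -> T x y (+) T y x.

(* Copies are not required to be induced. *)
Definition contains_copy (V W : finType) (D : rel V) (T : rel W) : Prop :=
  exists f : V -> W, injective f /\ forall x y : V, D x y -> T (f x) (f y).

Definition unavoidable (V : finType) (D : rel V) (N : nat) : Prop :=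
  forall T : rel 'I_N, tournament T -> contains_copy D T.

(* A predicate rather than a function: the minimum need not exist
   for a digraph with a directed cycle, so any total function would need an
   arbitrary default value. *)
Definition is_oriented_ramsey (V : finType) (D : rel V) (r : nat) : Prop :=
  unavoidable D r /\ forall N : nat, unavoidable D N -> r <= N.

(* The partition V_1, ..., V_H is encoded by the function h sending a vertex to
   the index of its part, shifted to start at 0.  Empty parts are harmless: no
   edge skips over an empty part, so such parts can be deleted. *)
Definition graded (V : finType) (D : rel V) : Prop :=
  exists (H : nat) (h : V -> 'I_H), forall x y : V, D x y -> h y = (h x).+1 :> nat.

Definition max_indegree (V : finType) (D : rel V) : nat :=
  \max_(x : V) #|[set y | D y x]|.

Definition max_outdegree (V : finType) (D : rel V) : nat :=
  \max_(x : V) #|[set y | D x y]|.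

Definition max_degree (V : finType) (D : rel V) : nat :=
  \max_(x : V) #|[set y | D x y || D y x]|.

(* Main.v *)
(* Write d and q for the maximum in- and out-degree.  In a median order of the
   tournament every vertex is dominated by at least half of any interval ending
   just before it; hence, if B lies in a short window J and I is the interval
   preceding J, at least 2d times as long, then every vertex of B is dominated by
   a proportion of at least (1 - 1/(2d))/2 of I.  Dependent random choice with 2d
   sampled vertices of B then gives A in I, of size of order 4^(-d) #|I|, in which
   all but a tiny proportion of the d-tuples have many common out-neighbours in B.
   By pigeonhole A is dense in a short window of I, and the construction is
   repeated from there, moving left by one level of D each time.  D is finally
   embedded level by level from left to right: the images of the in-neighbours of
   a vertex always form a tuple with many common out-neighbours in the next
   window. *)
From Stdlib Require Import Classical.
Require Import Defs.
From mathcomp Require Import all_boot.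
From mathcomp Require Import zify.

Set Implicit Arguments.
Unset Strict Implicit.
Unset Printing Implicit Defensive.

(** * Elementary inequalities *)

Lemma leq_expn_base m n e : m <= n -> m ^ e <= n ^ e.
Proof. by case: e => // e; rewrite leq_exp2r. Qed.

Lemma ltn_sum_strict (I : finType) (P : pred I) (F G : I -> nat) x :
  P x -> (forall i, P i -> F i < G i) -> \sum_(i | P i) F i < \sum_(i | P i) G i.
Proof.
move=> Px FG; rewrite (bigD1 x) // [ltnRHS](bigD1 x) //= -addSn leq_add ?FG //.
by apply: leq_sum => i /andP[Pi _]; apply/ltnW/FG.
Qed.

(** The convex function x ^ t.+1 lies above its tangent at c; [power_mean] sums this over A. *)
Lemma AMGM_expn t a c : t.+1 * (c ^ t * a) <= a ^ t.+1 + t * c ^ t.+1.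
Proof.
elim: t => [|t IH]; first by rewrite !expn1 expn0; lia.
have H := leq_mul (leqnn a) IH.
have sq : 2 * (a * c) <= a * a + c * c by rewrite !mulnn (nat_Cauchy a c).
have sq' := leq_mul (leqnn (t.+1 * c ^ t)) sq.
rewrite !expnS in H *; move: (a ^ t) (c ^ t) H sq' => x y H sq'.
nia.
Qed.

Lemma power_mean (I : finType) (A : {set I}) (F : I -> nat) c t :
  #|A| * c <= \sum_(i in A) F i -> #|A| * c ^ t.+1 <= \sum_(i in A) F i ^ t.+1.
Proof.
move=> le_sum.
have tangent : t.+1 * c ^ t * \sum_(i in A) F i
    <= \sum_(i in A) F i ^ t.+1 + #|A| * (t * c ^ t.+1).
  rewrite big_distrr /= -sum_nat_const -big_split /=.
  by apply: leq_sum => i _; rewrite -mulnA AMGM_expn.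
have := leq_trans (leq_mul (leqnn (t.+1 * c ^ t)) le_sum) tangent.
by rewrite expnS; nia.
Qed.

Lemma bernoulli_expn m d : m.+1 ^ d.+1 <= m ^ d.+1 + d.+1 * m.+1 ^ d.
Proof.
elim: d => [|d IH]; first by rewrite !expn1 expn0; lia.
rewrite expnS (expnS m d.+1) (expnS m.+1 d).
have : m ^ d.+1 <= m.+1 ^ d.+1 by rewrite leq_exp2r.
rewrite (expnS m.+1 d) in IH *.
nia.
Qed.

(** Bernoulli gives (1 - 1/(2d))^d >= 1/2, and squaring leaves a factor 1/4. *)
Lemma expn_double_le d : 0 < d -> (2 * d) ^ (2 * d) <= 4 * (2 * d).-1 ^ (2 * d).
Proof.
case: d => // d _.
have half : (2 * d.+1) ^ d.+1 <= 2 * (2 * d.+1).-1 ^ d.+1.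
  have -> : 2 * d.+1 = (2 * d).+1.+1 by lia.
  have := bernoulli_expn (2 * d).+1 d; rewrite /= expnS; nia.
by rewrite mulnC !expnM -[4]/(2 ^ 2) -expnMn leq_exp2r // mulnC.
Qed.

(** * Greedy embedding avoiding bad tuples *)

Section BadExtensions.

Variable W : finType.
Implicit Types (A B : {set W}) (s : seq W).

(* The number of ways to extend s by k elements of A, with repetitions, to a
   bad sequence. *)
Fixpoint bad_ext (bad : pred (seq W)) A k s : nat :=
  if k is k'.+1 then \sum_(v in A) bad_ext bad A k' (v :: s) else bad s.

Lemma bad_ext_max (bad : pred (seq W)) A k s :
  (forall v s', bad s' -> bad (v :: s')) -> bad s -> #|A| ^ k <= bad_ext bad A k s.
Proof.
move=> badS; elim: k s => [|k IH] s bad_s /=; first by rewrite bad_s.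
by rewrite expnS -sum_nat_const; apply: leq_sum => v _; apply/IH/badS.
Qed.

(** Markov's inequality: each v in the set accounts for at least (#|A| / X)^k bad extensions of
    s. *)
Lemma few_bad_extensions bad A X k s :
  X ^ k.+1 * bad_ext bad A k.+1 s < #|A| ^ k.+1 ->
  X * #|[set v in A | #|A| ^ k <= X ^ k * bad_ext bad A k (v :: s)]| < #|A|.
Proof.
move=> few; rewrite ltnNge; apply/negP => many; move: few; rewrite ltnNge => /negP; apply.
set N := [set v in A | _] in many.
have le_N : #|N| * #|A| ^ k <= X ^ k * bad_ext bad A k.+1 s.
  rewrite -sum_nat_const /= big_distrr /=.
  rewrite [leqRHS](bigID [in N]) /=; apply: leq_trans (leq_addr _ _).
  rewrite [leqRHS](eq_bigl [in N]).
    by apply: leq_sum => v; rewrite inE => /andP[].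
  by move=> v; rewrite inE; case: (v \in A).
rewrite !expnS -mulnA; apply: leq_trans (leq_mul (leqnn X) le_N).
by rewrite mulnA leq_mul2r many orbT.
Qed.

(* The vertices of ys are embedded one at a time, keeping for every hyperedge z
   with j embedded vertices fewer than (#|A| / X) ^ (d - j) bad extensions of
   its partial image.  At each step a hyperedge rules out at most b images. *)
Lemma greedy_embedding (V : finType) (f0 : V -> W) (e : V -> {set V})
    (C : V -> {set W}) (bad : pred (seq W)) A (X d q b r : nat) (ys : seq V) :
    (forall z, #|e z| <= d) -> (forall y, #|[set z | y \in e z]| <= q) ->
    X ^ d * bad_ext bad A d [::] < #|A| ^ d -> #|A| <= X * b.+1 ->
    uniq ys -> size ys <= r ->
    {in ys, forall y, C y \subset A} -> {in ys, forall y, r + q * b <= #|C y|} ->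
  exists f : V -> W,
    [/\ {in ys &, injective f}, {in ys, forall y, f y \in C y}
      & forall z, let s := [seq f y | y <- ys & y \in e z] in
          X ^ (d - size s) * bad_ext bad A (d - size s) s < #|A| ^ (d - size s)].
Proof.
move=> e_le e_deg bad0 Ab.
elim: ys => [|y ys IH] /=; first by exists f0; split=> // z; rewrite /= subn0.
move=> /andP[ny uys] sz CA Cbig.
have sub_ys u : u \in ys -> u \in y :: ys by rewrite inE orbC => ->.
have [f [f_inj fC f_bad]] := IH uys (ltnW sz) (fun u uys => CA u (sub_ys u uys))
                                (fun u uys => Cbig u (sub_ys u uys)).
pose s z := [seq f y | y <- ys & y \in e z].
(* Entries still missing from the image of z once y is placed; [size_s] rules out truncation when y
   is in [e z]. *)
pose k z := (d - size (s z)).-1.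
pose N z := [set v in A | #|A| ^ k z <= X ^ k z * bad_ext bad A (k z) (v :: s z)].
have size_s z : y \in e z -> size (s z) < d.
  move=> yz; rewrite size_map; apply: leq_trans (e_le z).
  have uy : uniq (y :: [seq y <- ys | y \in e z]).
    by rewrite /= mem_filter negb_and ny orbT filter_uniq.
  rewrite -[_.+1]/(size (y :: [seq y <- ys | y \in e z])) -(card_uniqP uy).
  apply/subset_leq_card/subsetP => u; rewrite inE mem_filter.
  by case/orP => [/eqP ->|/andP[]].
have N_le z : y \in e z -> #|N z| <= b.
  move=> yz; have dk : d - size (s z) = (k z).+1 by rewrite /k prednK // subn_gt0 size_s.
  have := f_bad z; rewrite /= -/(s z) dk => /few_bad_extensions /leq_trans/(_ Ab).
  by rewrite ltn_mul2l => /andP[].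
pose avoid := [set v in map f ys] :|: \bigcup_(z | y \in e z) N z.
have avoid_lt : #|avoid| < #|C y|.
  apply: leq_trans (Cbig y (mem_head _ _)).
  apply: leq_ltn_trans (leq_card_setU _ _) _.
  rewrite -addSn leq_add //.
    by apply: leq_trans sz; rewrite ltnS cardsE -(size_map f) card_size.
  apply: leq_trans (_ : \sum_(z | y \in e z) #|N z| <= _).
    elim/big_rec2: _ => [|z m n _ IHn]; first by rewrite cards0.
    by apply: leq_trans (leq_card_setU _ _) _; rewrite leq_add2l.
  apply: leq_trans (leq_mul (e_deg y) (leqnn b)); rewrite -sum_nat_const.
  rewrite [leqRHS](eq_bigl (fun z => y \in e z)); last by move=> z; rewrite inE.
  by apply: leq_sum => z; apply: N_le.
have /subsetPn[v Cv] : ~~ (C y \subset avoid).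
  by apply: contraTN avoid_lt => /subset_leq_card; rewrite leqNgt.
rewrite !inE negb_or => /andP[v_fresh v_ok].
pose f' u := if u == y then v else f u.
have f'E : {in ys, f' =1 f}.
  by move=> u uys'; rewrite /f'; case: eqP => // uy; rewrite -uy uys' in ny.
have f'y : f' y = v by rewrite /f' eqxx.
exists f'; split.
- move=> u1 u2; rewrite !inE => /predU1P[->|u1ys] /predU1P[->|u2ys] //; rewrite ?f'y ?f'E //.
  + by move=> vE; rewrite vE map_f in v_fresh.
  + by move=> vE; rewrite -vE map_f in v_fresh.
  + exact: f_inj.
- by move=> u; rewrite inE => /predU1P[->|uys']; rewrite ?f'y ?f'E //; apply: fC.
- move=> z.
  have eq_s : [seq f' y | y <- ys & y \in e z] = s z.
    by apply/eq_in_map => u; rewrite mem_filter => /andP[_]; apply: f'E.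
  case: ifP => yz /=; rewrite eq_s; last exact: f_bad.
  rewrite f'y /= (_ : d - (size (s z)).+1 = k z); last by rewrite /k subnS.
  rewrite ltnNge; apply: contra v_ok => v_bad.
  apply/bigcupP; exists z => //; rewrite inE v_bad andbT.
  exact: (subsetP (CA y (mem_head _ _))).
Qed.

End BadExtensions.

(** * Dependent random choice *)

Section DependentRandomChoice.

Variables (W : finType) (E : rel W).
Implicit Types (A B I : {set W}) (s : seq W).

Definition common_out B s := [set v in B | all (E^~ v) s].
Definition sparse B K : pred (seq W) := fun s => K * #|common_out B s| < #|B|.

Lemma sparse_cons B K v s : sparse B K s -> sparse B K (v :: s).
Proof.
apply: leq_ltn_trans; rewrite leq_mul2l; apply/orP; right.
by apply/subset_leq_card/subsetP => u; rewrite !inE /= => /and3P[-> _ ->].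
Qed.

Section Sampling.

Variables (I B : {set W}) (t : nat).
Implicit Type x : {ffun 'I_t -> W}.

Definition common_in x := [set u in I | [forall j, E u (x j)]].

(** Double counting: u in I belongs to [common_in x] exactly when all entries of x are
    out-neighbours of u. *)
Lemma sum_common_in :
  \sum_(x in ffun_on [in B]) #|common_in x| = \sum_(u in I) #|[set v in B | E u v]| ^ t.
Proof.
under eq_bigr do rewrite -sum1_card.
rewrite (exchange_big_dep [in I]) /=; last by move=> x u _; rewrite inE => /andP[].
apply: eq_bigr => u uI.
rewrite -[t in RHS]card_ord -card_ffun_on sum1_card; apply: eq_card => x.
rewrite -[LHS]/((x \in ffun_on [in B]) && (u \in common_in x)) [u \in _]inE uI /=.
apply/andP/ffun_onP => [[/ffun_onP xB /forallP Ex] j | xB]; first by rewrite inE xB Ex.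
split; first by apply/ffun_onP => j; have := xB j; rewrite inE => /andP[].
by apply/forallP => j; have := xB j; rewrite inE => /andP[].
Qed.

(** A sparse sequence lies in [common_in x] only if all t entries of x fall among its fewer than
    #|B| / K common out-neighbours, so for at most (#|B| / K)^t samples x. The prefix s carries the
    induction. *)
Lemma sum_bad_ext K k s :
  K ^ t * \sum_(x in ffun_on [in B] | all [in common_in x] s)
            bad_ext (sparse B K) (common_in x) k s <= #|I| ^ k * #|B| ^ t.
Proof.
elim: k s => [|k IH] s /=.
  rewrite mul1n; case sp: (sparse B K s); last by rewrite big1 ?muln0.
  apply: leq_trans (_ : K ^ t * #|common_out B s| ^ t <= _); last first.
    by rewrite -expnMn leq_expn_base // ltnW.
  rewrite leq_mul2l; apply/orP; right.
  rewrite -[t in leqRHS]card_ord -card_ffun_on sum1_card.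
  apply/subset_leq_card/subsetP => x /andP[/ffun_onP xB /allP xs].
  apply/ffun_onP => j; rewrite inE xB /=; apply/allP => u us.
  by have := xs u us; rewrite inE => /andP[_ /forallP].
rewrite (exchange_big_dep [in I]) /=; last first.
  by move=> x u _; rewrite inE => /andP[].
rewrite big_distrr /= expnS -mulnA -sum_nat_const.
apply: leq_sum => u uI; apply: leq_trans (IH (u :: s)).
rewrite leq_mul2l; apply/orP; right.
by apply/eq_leq/eq_bigl => x /=; rewrite -andbA [_ && all _ _]andbC.
Qed.

End Sampling.

(* Averaging over x in B ^ (2 d): otherwise each A = common_in I x satisfies
   2 P #|A| #|I|^(d-1) < #|I|^d + (2 P X)^d bad_ext A, whose sum over x
   contradicts the density hypothesis and sum_bad_ext. *)
Lemma dependent_random_choice I B d P K X :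
    0 < d -> 0 < #|I| -> 0 < #|B| -> K ^ 2 = 2 * P * X ->
    #|I| * #|B| ^ (2 * d) <= P * \sum_(u in I) #|[set v in B | E u v]| ^ (2 * d) ->
  exists A, [/\ A \subset I, #|I| <= 2 * P * #|A|
              & X ^ d * bad_ext (sparse B K) A d [::] < #|A| ^ d].
Proof.
move=> d0 I0 B0 KPX dense; set t := 2 * d in dense.
pose good (x : {ffun 'I_t -> W}) := let A := common_in I x in
  (#|I| <= 2 * P * #|A|) && (X ^ d * bad_ext (sparse B K) A d [::] < #|A| ^ d).
case: (pickP [pred x | x \in ffun_on [in B] & good x]) => [x /= /and3P[_ xl xb]|none].
  by exists (common_in I x); split=> //; apply/subsetP => u; rewrite inE => /andP[].
have S1 := sum_common_in I B t; rewrite -S1 in dense.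
have := sum_bad_ext I B t K d [::].
rewrite (eq_bigl [in ffun_on [in B]]); last by move=> x; rewrite /= andbT.
have -> : K ^ t = (2 * P) ^ d * X ^ d by rewrite /t expnM KPX -expnMn.
set S := \sum_(x in _) _ => S2.
have each (x : {ffun 'I_t -> W}) : x \in ffun_on [in B] -> 2 * P * #|common_in I x| * #|I| ^ d.-1 <
   #|I| ^ d + (2 * P) ^ d * X ^ d * bad_ext (sparse B K) (common_in I x) d [::].
  move=> xB; have := none x; rewrite /= xB /= /good.
  set a := #|common_in I x|; set e := bad_ext _ _ _ _.
  have Id : #|I| ^ d = #|I| * #|I| ^ d.-1 by rewrite -expnS prednK.
  have I1 : 0 < #|I| ^ d.-1 by rewrite expn_gt0 I0.
  (* A small [common_in I x] is covered by the first summand; for a large one, failure of [good]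
     makes the second summand big enough. *)
  case: (leqP #|I| (2 * P * a)) => [le_I /= /negbT | lt_I _]; last first.
    by rewrite Id; apply: leq_trans (leq_addr _ _); rewrite ltn_mul2r I1 lt_I.
  rewrite -leqNgt => le_a.
  apply: leq_ltn_trans (_ : (2 * P) ^ d * X ^ d * e < _); last first.
    by rewrite -[ltnLHS]add0n ltn_add2r expn_gt0 I0.
  rewrite -[leqRHS]mulnA; apply: leq_trans (leq_mul (leqnn _) le_a).
  rewrite -expnMn -[d in leqRHS](prednK d0) expnS.
  by rewrite leq_mul2l leq_expn_base ?orbT.
have cardM : #|ffun_on [in B] : pred {ffun 'I_t -> W}| = #|B| ^ t.
  by rewrite card_ffun_on card_ord.
have [x0 x0B] : exists x : {ffun 'I_t -> W}, x \in ffun_on [in B].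
  by apply/card_gt0P; rewrite cardM expn_gt0 B0.
have : \sum_(x : {ffun 'I_t -> W} | x \in ffun_on [in B]) 2 * P * #|common_in I x| * #|I| ^ d.-1 <
  \sum_(x : {ffun 'I_t -> W} | x \in ffun_on [in B]) (#|I| ^ d +
     (2 * P) ^ d * X ^ d * bad_ext (sparse B K) (common_in I x) d [::]).
  exact: (ltn_sum_strict x0B).
rewrite big_split /= sum_nat_const -big_distrr /= -/S cardM.
rewrite -big_distrl -big_distrr /= ltnNge => /negP; case.
apply: leq_trans (leq_add (leqnn _) S2) _.
have -> : #|I| ^ d = #|I| * #|I| ^ d.-1 by rewrite -expnS prednK.
have twice a b c : a * b * (2 * c) <= 2 * a * b * c by nia.
apply: leq_trans (twice _ _ _); apply: leq_trans (leq_mul dense (leqnn _)).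
lia.
Qed.

(** Double count the edges from I to B and apply convexity to the average (1 - 1/(2d))/2: the power
    2d of 1/2 costs 4^d, and [expn_double_le] bounds the rest by one more factor 4. *)
Lemma density_power I B d : 0 < d ->
  {in B, forall v, (2 * d).-1 * #|I| <= 4 * d * #|[set u in I | E u v]|} ->
  #|I| * #|B| ^ (2 * d) <= 4 ^ d.+1 * \sum_(u in I) #|[set v in B | E u v]| ^ (2 * d).
Proof.
move=> d0 dense.
have edges : \sum_(u in I) #|[set v in B | E u v]| = \sum_(v in B) #|[set u in I | E u v]|.
  under eq_bigr do rewrite -sum1_card.
  rewrite (exchange_big_dep [in B]) /=; last by move=> x u _; rewrite inE => /andP[].
  apply: eq_bigr => v vB; rewrite -sum1_card; apply: eq_bigl => u.
  by rewrite !inE vB.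
have avg : #|I| * ((2 * d).-1 * #|B|) <= \sum_(u in I) 4 * d * #|[set v in B | E u v]|.
  rewrite -big_distrr /= edges big_distrr /= mulnA [leqLHS]mulnC [#|I| * _]mulnC.
  by rewrite -sum_nat_const; apply: leq_sum => v; apply: dense.
have := @power_mean _ _ _ _ (2 * d).-1 avg; rewrite prednK ?muln_gt0 //.
under [X in _ <= X -> _]eq_bigr do rewrite expnMn.
rewrite -big_distrr /= expnMn; set S := \sum_(u in I) _ => pm.
have e4 : (4 * d) ^ (2 * d) = 4 ^ d * (2 * d) ^ (2 * d).
  by rewrite -[4]/(2 * 2) -mulnA expnMn [2 ^ (2 * d)]expnM.
have hd := expn_double_le d0.
have D0 : 0 < (2 * d) ^ (2 * d) by rewrite expn_gt0 muln_gt0 d0.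
rewrite -(leq_pmul2l D0).
have := leq_mul hd (leqnn (#|I| * #|B| ^ (2 * d))) => /leq_trans; apply.
rewrite e4 in pm.
have := leq_mul (leqnn 4) pm; rewrite expnS.
move: ((2 * d).-1 ^ _) (#|B| ^ _) (4 ^ d) ((2 * d) ^ _) => a b c D; lia.
Qed.

End DependentRandomChoice.

(** * Median orders *)

Section MedianOrder.

Variables (W : eqType) (T : rel W).

(** Counts the edges pointing from left to right; a median order maximises it. *)
Fixpoint forward (s : seq W) : nat :=
  if s is x :: s' then count (T x) s' + forward s' else 0.

Lemma forward_cat a b :
  forward (a ++ b) = forward a + forward b + sumn [seq count (T x) b | x <- a].
Proof. by elim: a => [|x a IH] /=; rewrite ?addn0 // count_cat IH; lia. Qed.

(* Optimality of an order, tested against moving v to the left past b. *)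
Lemma forward_move a b v c :
  forward (a ++ v :: b ++ c) <= forward (a ++ b ++ v :: c) ->
  count (T v) b <= count (T^~ v) b.
Proof.
rewrite !forward_cat /= !count_cat !forward_cat /=.
have -> : [seq count (T x) (v :: b ++ c) | x <- a] = [seq count (T x) (b ++ v :: c) | x <- a].
  by apply: eq_map => x; rewrite /= !count_cat /=; lia.
have -> : sumn [seq count (T x) (v :: c) | x <- b]
        = count (T^~ v) b + sumn [seq count (T x) c | x <- b].
  by elim: b => [|x b IH] //=; rewrite IH; lia.
lia.
Qed.

Lemma count_in_out (v : W) b : (forall x, x != v -> T x v (+) T v x) -> v \notin b ->
  count (T v) b + count (T^~ v) b = size b.
Proof.
move=> tour; elim: b => [|x b IH] //=; rewrite inE negb_or eq_sym => /andP[xv vb].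
by have := tour x xv; have := IH vb; case: (T x v); case: (T v x) => //=; lia.
Qed.

End MedianOrder.

(** In an order maximising [forward], moving the vertex at j to the front of [i, j) gains nothing,
    so at least half of that interval dominates it. *)
Lemma median_order N (T : rel 'I_N) : tournament T ->
  exists s : 'I_N -> 'I_N, injective s /\
    forall (i : nat) (j : 'I_N), i <= j ->
      j - i <= 2 * #|[set k : 'I_N | i <= k < j & T (s k) (s j)]|.
Proof.
move=> [_ tour].
pose t0 : N.-tuple 'I_N := ord_tuple N.
have t0u : uniq t0 by rewrite val_ord_tuple enum_uniq.
have [t tu tmax] := @arg_maxnP _ t0 (fun t : N.-tuple 'I_N => uniq t) (fun t => forward T t) t0u.
exists (tnth t); split; first exact/tuple_uniqP.
move=> i j ij; set v := tnth t j.
set a := take i t; set b := drop i (take j t); set c := drop j.+1 t.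
have jt : j < size t by rewrite size_tuple.
have tE : val t = a ++ b ++ v :: c.
  have vE : v = nth v t j by rewrite {1}/v (tnth_nth v).
  rewrite {1}vE -drop_nth // catA.
  have -> : a ++ b = take j t by rewrite /a /b -(@take_takel _ i j t) // cat_take_drop.
  by rewrite cat_take_drop.
have pE : perm_eq (a ++ v :: b ++ c) t.
  by rewrite tE perm_cat2l perm_sym -cat1s perm_catCA.
have szt : size (a ++ v :: b ++ c) == N by rewrite (perm_size pE) size_tuple.
have := tmax (Tuple szt); rewrite /= (perm_uniq pE) tu => /(_ isT).
rewrite /= {1}tE => /forward_move le_count.
have vb : v \notin b.
  by move: tu; rewrite tE !cat_uniq /= => /and3P[_ _ /and3P[_ /norP[]]].
have le_b : j - i <= 2 * count (T^~ v) b.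
  have <- : size b = j - i by rewrite size_drop size_takel // ltnW.
  by rewrite -(count_in_out (fun x xv => tour x v xv) vb) mul2n -addnn leq_add2r.
have cnt : count (T^~ v) b = #|[set k : 'I_N | i <= k < j & T (tnth t k) v]|.
  pose Q k := (i <= k < j) && T (nth v t k) v.
  have jN := ltn_ord j.
  have -> : #|[set k : 'I_N | i <= k < j & T (tnth t k) v]| = count Q (iota 0 N).
    rewrite -val_enum_ord count_map -size_filter cardE [in LHS]/enum_mem -enumT; congr size.
    by apply: eq_filter => k; rewrite !inE /Q /= (tnth_nth v).
  have -> : iota 0 N = iota 0 (i + (j - i) + (N - j)) by congr iota; lia.
  rewrite !iotaD !count_cat add0n.
  have out m n : (forall k, m <= k < m + n -> ~~ (i <= k < j)) -> count Q (iota m n) = 0.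
    move=> mn; apply/eqP; rewrite -leqn0 leqNgt -has_count; apply/hasPn => k.
    by rewrite mem_iota => /mn /negbTE; rewrite /Q => ->.
  rewrite (out 0) 1?(out (i + (j - i))) ?addn0 ?add0n; try by move=> k; lia.
  have -> : b = [seq nth v t k | k <- iota i (j - i)].
    rewrite map_nth_iota ?size_tuple; last by lia.
    by rewrite /b take_drop subnK.
  rewrite count_map; apply: eq_in_count => k; rewrite mem_iota /Q /= => ik.
  by have -> : i <= k < j by lia.
by rewrite -cnt.
Qed.

(** * Grading and windows *)

(** Pigeonhole over K consecutive blocks of length w. *)
Lemma dense_block N (A : {set 'I_N}) K w p :
    0 < K -> {in A, forall v : 'I_N, p <= v < p + K * w} ->
  exists2 p' : nat, p <= p' /\ p' + w <= p + K * w
    & #|A| <= K * #|[set v in A | p' <= v < p' + w]|.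
Proof.
move=> K0 Ap.
pose blk (i : nat) := [set v in A | p + i * w <= v < p + i * w + w].
case: (pickP [pred i : 'I_K | #|A| <= K * #|blk i|]) => [i /= le_A | none].
  by exists (p + i * w) => //; split; [lia | have := ltn_ord i; nia].
exfalso.
have cover : A \subset \bigcup_(i < K) blk i.
  apply/subsetP => v vA; have /andP[pv vp] := Ap v vA.
  have w0 : 0 < w by case: (w) vp => //; lia.
  have iK : (v - p) %/ w < K by rewrite ltn_divLR //; lia.
  apply/bigcupP; exists (Ordinal iK) => //; rewrite inE vA /=.
  by have := divn_eq (v - p) w; have := ltn_pmod (v - p) w0; lia.
have le1 : #|A| <= \sum_(i < K) #|blk i|.
  apply: leq_trans (subset_leq_card cover) _.
  elim/big_rec2: _ => [|z m n _ IHn]; first by rewrite cards0.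
  by apply: leq_trans (leq_card_setU _ _) _; rewrite leq_add2l.
have : \sum_(i < K) K * #|blk i| < \sum_(i < K) #|A|.
  apply: (ltn_sum_strict (x := Ordinal K0)) => // i _.
  by have /negbT := none i; rewrite /= -ltnNge.
by rewrite -big_distrr sum_nat_const card_ord ltn_mul2l K0 /= ltnNge le1.
Qed.

(* Only nonempty parts are numbered, from the last one backwards, so that the
   number of levels is at most #|V|. *)
Lemma graded_compress (V : finType) (D : rel V) : graded D ->
  exists g : V -> nat, (forall v, 0 < g v <= #|V|) /\ forall x y, D x y -> g x = (g y).+1.
Proof.
move=> [H [h hD]].
pose P v := [set l in [set h u | u : V] | h v <= l].
exists (fun v => #|P v|); split=> [v|x y Dxy].
  apply/andP; split.
    by apply/card_gt0P; exists (h v); rewrite inE leqnn andbT imset_f.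
  apply: leq_trans (_ : #|[set h u | u : V]| <= _); last exact: leq_imset_card.
  by apply/subset_leq_card/subsetP => l; rewrite inE => /andP[].
have -> : P x = h x |: P y.
  apply/setP => l; rewrite !inE (hD _ _ Dxy) leq_eqVlt.
  rewrite andb_orr; congr (_ || _).
  apply/andP/eqP => [[_ /eqP hl]|->]; last by rewrite imset_f.
  exact/esym/val_inj.
by rewrite cardsU1 !inE (hD _ _ Dxy) ltnn andbF.
Qed.

Lemma card_interval N a b : b <= N -> #|[set k : 'I_N | a <= k < b]| = b - a.
Proof.
move=> bN; rewrite -sum1_card -[b - a]muln1 -sum_nat_const_nat.
rewrite (big_nat_widen _ _ _ _ _ bN) (big_nat_widenl _ 0) // big_mkord.
by apply: eq_bigl => k; rewrite inE andbC.
Qed.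

(** At least half of [p - L, v) dominates v. Discarding the dominators in [p, v), an interval
    shorter than w, leaves at least (L - w)/2 before p, and w <= L/(2d). *)
Lemma window_density N (T : rel 'I_N) (B : {set 'I_N}) d p w L :
    (forall (i : nat) (j : 'I_N), i <= j ->
       j - i <= 2 * #|[set k : 'I_N | i <= k < j & T k j]|) ->
    0 < d -> 2 * d * w <= L -> L <= p -> p <= N ->
    {in B, forall v : 'I_N, p <= v < p + w} ->
  {in B, forall v, (2 * d).-1 * #|[set k : 'I_N | p - L <= k < p]|
     <= 4 * d * #|[set u in [set k : 'I_N | p - L <= k < p] | T u v]|}.
Proof.
move=> median d0 dw Lp pN Bp v vB; have /andP[pv vw] := Bp v vB.
rewrite card_interval //; set S := [set u in _ | _].
have cover : [set k : 'I_N | p - L <= k < v & T k v] \subset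
    S :|: [set k : 'I_N | p <= k < v].
  by apply/subsetP => k; rewrite !inE => /andP[/andP[-> ->] ->]; case: leqP.
have := median (p - L) v (leq_trans (leq_subr _ _) pv).
have := leq_trans (subset_leq_card cover) (leq_card_setU _ _).
have vN := ltnW (ltn_ord v).
rewrite (card_interval p vN) => cov med.
have twice : L <= 2 * #|S| + w by lia.
have -> : p - (p - L) = L by lia.
have := leq_mul (leqnn (2 * d)) twice.
have : (2 * d).-1 * L + L = 2 * d * L by nia.
move: dw; move: (#|S|) => s; nia.
Qed.

Section Levels.

Variables (V : finType) (D : rel V) (g : V -> nat).

Definition level k := [set v | g v == k].

(* Consecutive windows must have comparable lengths, which the true level sizes
   do not provide: smooth k is at least #|level k|, satisfies
   smooth k <= 2 * smooth k.+1, and still has linear sum. *)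
Fixpoint smooth k : nat := if k is k'.+1 then #|level k| + uphalf (smooth k') else 1.

Lemma smooth_gt0 k : 0 < smooth k.
Proof. by elim: k => //= k IH; rewrite addn_gt0 uphalf_gt0 IH orbT. Qed.

Lemma smooth_double k : smooth k <= 2 * smooth k.+1.
Proof. by have := uphalfE (smooth k); move=> /=; lia. Qed.

Lemma sum_level m : \sum_(k < m) #|level k.+1| <= #|V|.
Proof.
apply: leq_trans (_ : #|[set v | g v <= m]| <= _); last exact: max_card.
elim: m => [|m IH]; first by rewrite big_ord0.
rewrite big_ord_recr /= -[leqRHS](cardsID [set v | g v <= m]) leq_add //.
  apply: leq_trans IH _; apply/subset_leq_card/subsetP => v; rewrite !inE => gv.
  by rewrite gv leqW.
by apply/subset_leq_card/subsetP => v; rewrite !inE -ltnNge => /eqP ->; rewrite leqnn.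
Qed.

Lemma sum_smooth m : \sum_(k < m.+1) smooth k <= m + 2 + 2 * #|V|.
Proof.
(* The extra [smooth m] pays for the halved term of [smooth m.+1]; rounding up costs 1 per level. *)
have step : \sum_(k < m.+1) smooth k + smooth m <= m + 2 + 2 * \sum_(k < m) #|level k.+1|.
  elim: m => [|m IH]; first by rewrite big_ord_recr !big_ord0.
  rewrite big_ord_recr [\sum_(k < m.+1) #|_|]big_ord_recr /=.
  move: IH; have := uphalfE (smooth m).
  by move: (smooth m) (\sum_(i < _) _) #|level m.+1| (\sum_(i < m) _) => s S l S1; lia.
by have := sum_level m; lia.
Qed.

Variables (d q : nat).
Hypotheses (d_gt0 : 0 < d) (q_gt0 : 0 < q).

(** Solves [sparsity ^ 2 = 2 * 4 ^ d.+1 * X] for the X = 8 * d * q * [sparsity] used in the greedy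
    embedding. *)
Definition sparsity := 8 ^ 2 * d * q * 4 ^ d.
(** Makes #|A| >= [span k] / (2 * 4 ^ d.+1) at least 8 * d * [sparsity] * [smooth k], enough room
    for level k. *)
Definition width k := 4 * 4 ^ d.+1 * sparsity * smooth k.
(** The factor is 4 * d instead of 2 * d to absorb the doubling in [smooth_double]. *)
Definition span k := 4 * d * width k.

Lemma sparsity_gt0 : 0 < sparsity.
Proof. by rewrite !muln_gt0 d_gt0 q_gt0 !expn_gt0. Qed.

Lemma width_gt0 k : 0 < width k.
Proof. by rewrite !muln_gt0 smooth_gt0 d_gt0 q_gt0 !expn_gt0. Qed.

Lemma width_span k : 2 * d * width k <= span k.+1.
Proof.
rewrite /span /width; have := smooth_double k.
move: (smooth k) (smooth k.+1) (4 * 4 ^ d.+1 * sparsity) => a b c ab.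
have -> : 4 * d * (c * b) = 2 * d * (c * (2 * b)) by lia.
by rewrite !leq_mul.
Qed.

Lemma sum_span m : 0 < #|V| -> m <= #|V| ->
  \sum_(k < m.+1) span k <= 8 ^ 5 * q * d ^ 2 * 2 ^ (4 * d) * #|V|.
Proof.
move=> V0 mV; rewrite /span /width -!big_distrr /=.
have -> : 4 * d * (4 * 4 ^ d.+1 * sparsity * \sum_(k < m.+1) smooth k)
    = 8 ^ 4 * q * d ^ 2 * 2 ^ (4 * d) * \sum_(k < m.+1) smooth k.
  rewrite /sparsity (expnS 4 d) -(mulnn d) (_ : 2 ^ (4 * d) = 4 ^ d * 4 ^ d); last first.
    by rewrite expnM -expnMn.
  rewrite (_ : 8 ^ 4 = 64 * 8 ^ 2) //.
  move: (8 ^ 2) (4 ^ d) (\sum_(k < _) _) => a b S. lia.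
have := sum_smooth m; rewrite (expnS 8 4) => S.
apply: leq_trans (leq_mul (leqnn _) (_ : _ <= 8 * #|V|)) _; first by lia.
by move: (8 ^ 4) (d ^ 2) (2 ^ _) #|V| => a b c n; lia.
Qed.

Hypotheses (g_gt0 : forall v, 0 < g v) (gD : forall x y, D x y -> g x = (g y).+1).
Hypotheses (D_in : forall x, #|[set y | D y x]| <= d) (D_out : forall x, #|[set y | D x y]| <= q).
Variables (N : nat) (T : rel 'I_N).
Hypothesis median : forall (i : nat) (j : 'I_N), i <= j ->
  j - i <= 2 * #|[set k : 'I_N | i <= k < j & T k j]|.

(* Level k is to be mapped into the window [p, p + width k) and the levels below
   k to its right, for every choice of large candidate sets C y for the vertices
   of level k; such candidate sets are what the embedding of level k.+1 leaves. *)
Lemma level_embedding k : \sum_(j < k.+1) span j <= N ->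
  exists (p : nat) (B : {set 'I_N}),
    [/\ p <= N, N <= p + \sum_(j < k.+1) span j, 0 < #|B|,
        {in B, forall v : 'I_N, p <= v < p + width k}
      & forall C : V -> {set 'I_N},
          (forall y, g y = k -> C y \subset B /\ #|B| <= sparsity * #|C y|) ->
        exists f : V -> 'I_N,
          [/\ forall y, g y = k -> f y \in C y, forall y, g y <= k -> p <= f y,
              {in [pred y | g y <= k] &, injective f}
            & forall x y, g x <= k -> D x y -> T (f x) (f y)]].
Proof.
elim: k => [|k IH].
  (* Level 0 is empty by [g_gt0]: only the rightmost window is needed, and the map is arbitrary. *)
  rewrite big_ord_recr big_ord0 /= add0n => spanN.
  have wN : width 0 <= N by apply: leq_trans spanN; rewrite leq_pmull // muln_gt0 d_gt0.
  have cardB : #|[set v : 'I_N | N - width 0 <= v < N]| = width 0.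
    by rewrite card_interval ?subKn.
  exists (N - width 0), [set v : 'I_N | N - width 0 <= v < N].
  have wspan : width 0 <= span 0 by rewrite leq_pmull // muln_gt0 d_gt0.
  split; [exact: leq_subr | by lia | by rewrite cardB width_gt0 | |].
    by move=> v; rewrite inE subnK.
  have N0 : 0 < N by apply: leq_trans wN; apply: width_gt0.
  move=> C _; exists (fun=> Ordinal N0).
  by split=> [y|y|y z|y z]; have := g_gt0 y; rewrite ?inE; case: (g y).
rewrite big_ord_recr /=; move: IH; set S := \sum_(j < k.+1) span j => IH spanN.
have [p [B [pN Np B0 Bp emb]]] := IH (leq_trans (leq_addr _ _) spanN).
set L := span k.+1 in spanN *.
have Lp : L <= p by lia.
pose I := [set v : 'I_N | p - L <= v < p].
have cardI : #|I| = L by rewrite card_interval ?subKn.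
have L0 : 0 < L by rewrite muln_gt0 width_gt0 muln_gt0 d_gt0.
(* With this X the q * b excluded vertices fill at most half of any [C y]; the other half is for
   images already used. *)
pose X := 2 * (4 * d * sparsity) * q.
have X0 : 0 < X by rewrite !muln_gt0 d_gt0 q_gt0 !expn_gt0.
have KPX : sparsity ^ 2 = 2 * 4 ^ d.+1 * X.
  have sE : sparsity = 64 * d * q * 4 ^ d by [].
  rewrite -(mulnn sparsity) {1}sE /X expnS.
  by move: sparsity (4 ^ d) => a b; lia.
have dense := window_density median d_gt0 (width_span k) Lp pN Bp.
have [|A [AI IA Abad]] := dependent_random_choice d_gt0 _ B0 KPX (density_power d_gt0 dense).
  by rewrite cardI.
rewrite -/I cardI in IA.
have K0 : 0 < 4 * d by rewrite muln_gt0 d_gt0.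
have Ap : {in A, forall v : 'I_N, p - L <= v < p - L + 4 * d * width k.+1}.
  by move=> v /(subsetP AI); rewrite inE -/(span k.+1) -/L subnK.
have [p' [pp' p'w] AJ] := dense_block K0 Ap.
rewrite -/(span k.+1) -/L subnK // in p'w.
set J := [set v in A | _] in AJ.
have A0 : 0 < #|A| by move: L0 IA; case: #|A|; lia.
exists p', J; split; [by lia | by lia | by move: A0 AJ; case: #|J|; lia | |].
  by move=> v; rewrite inE => /andP[].
move=> C CJ; have [a0 _] := card_gt0P A0.
pose e z := [set x | D x z]; pose ys := enum (level k.+1).
have ysP y : (y \in ys) = (g y == k.+1) by rewrite mem_enum inE.
have JA : J \subset A by apply/subsetP => v; rewrite inE => /andP[].
have e_deg y : #|[set z | y \in e z]| <= q.
  by apply: leq_trans (D_out y); apply/eq_leq/eq_card => z; rewrite !inE.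
(* The largest b with [X * b < #|A|]. *)
pose b := #|A|.-1 %/ X.
have Ab : #|A| <= X * b.+1.
  by have := divn_eq #|A|.-1 X; have := ltn_pmod #|A|.-1 X0; rewrite -/b; nia.
have bA : X * b < #|A| by have := leq_trunc_div #|A|.-1 X; rewrite -/b; lia.
have szA : 2 * (4 * d * sparsity) * size ys <= #|A|.
  have szL : #|level k.+1| <= smooth k.+1 by apply: leq_addr.
  rewrite -cardE; move: IA szL; rewrite /L /span /width.
  have : 0 < 4 ^ d.+1 by rewrite expn_gt0.
  move: (4 ^ d.+1) sparsity (smooth _) #|level _| #|A| => P s m r a P0 IA rm.
  rewrite -(leq_pmul2l (_ : 0 < 2 * P)) ?muln_gt0 //; apply: leq_trans IA.
  have -> : 4 * d * (4 * P * s * m) = 2 * P * (2 * (4 * d * s) * m) by lia.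
  by rewrite !leq_mul.
have C_big : {in ys, forall y, size ys + q * b <= #|C y|}.
  move=> y; rewrite ysP => /eqP /CJ[_ JC].
  have AC : #|A| <= 4 * d * sparsity * #|C y|.
    by apply: leq_trans AJ _; rewrite -[leqRHS]mulnA leq_mul.
  have Q0 : 0 < 4 * d * sparsity by rewrite muln_gt0 sparsity_gt0 muln_gt0 d_gt0.
  move: AC szA bA; rewrite /X; move: (4 * d * sparsity) Q0 => Q Q0 AC szA bA.
  have r2 : 2 * size ys <= #|C y|.
    by rewrite -(leq_pmul2l Q0); apply: leq_trans AC; apply: leq_trans szA; lia.
  have b2 : 2 * (q * b) <= #|C y|.
    by rewrite -(leq_pmul2l Q0); apply: leq_trans AC; apply: leq_trans (ltnW bA); lia.
  by lia.
have CA : {in ys, forall y, C y \subset A}.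
  by move=> y; rewrite ysP => /eqP /CJ[Cy _]; apply: subset_trans Cy JA.
have [f1 [f1_inj f1C f1_bad]] := greedy_embedding (fun=> a0) D_in e_deg Abad Ab
  (enum_uniq _) (leqnn _) CA C_big.
(* In-neighbours of level k all lie in level k.+1, so choosing images in [C'] realises every edge
   between these levels. *)
pose C' z := common_out T B [seq f1 y | y <- ys & y \in e z].
have [y gy|f2 [f2C f2p f2_inj f2D]] := emb C'.
  split; first by apply/subsetP => v; rewrite inE => /andP[].
  (* If the image of the in-neighbours were sparse, all its extensions would be bad, against
     [f1_bad]. *)
  rewrite leqNgt; apply/negP => sp.
  have := f1_bad y; rewrite /= ltnNge => /negP; apply.
  apply: leq_trans (leq_pmull _ _); last by rewrite expn_gt0 X0.
  by apply: bad_ext_max => // v s; apply: sparse_cons.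
have f1J y : g y = k.+1 -> f1 y \in J.
  by move=> gy; have [/subsetP CJy _] := CJ y gy; apply/CJy/f1C; rewrite ysP gy.
have f1p y : g y = k.+1 -> p' <= f1 y < p.
  by move=> /f1J; rewrite inE => /andP[_ /andP[-> /leq_trans->]].
exists (fun y => if g y == k.+1 then f1 y else f2 y); split.
- by move=> y gy; rewrite gy eqxx; apply: f1C; rewrite ysP gy.
- move=> y; rewrite leq_eqVlt ltnS; case: eqP => [/f1p/andP[] // | _ /= /f2p].
  by apply: leq_trans; lia.
(* Images of level k.+1 lie before p, those of lower levels at or after p. *)
- move=> x y; rewrite !inE.
  rewrite (leq_eqVlt (g x)) (leq_eqVlt (g y)) !ltnS.
  case: eqP => [gx|_]; case: eqP => [gy|_] //=.
  + by move=> _ _; apply: f1_inj; rewrite ysP ?gx ?gy.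
  + move=> _ /f2p py xy; have /andP[_] := f1p x gx.
    by rewrite xy ltnNge py.
  + move=> /f2p px _ xy; have /andP[_] := f1p y gy.
    by rewrite -xy ltnNge px.
  + by move=> gx gy; apply: f2_inj.
- move=> x y; have := @gD x y; rewrite leq_eqVlt ltnS.
  case: eqP => [gx gxy _ Dxy | _ gxy /= gx Dxy].
    have gy : g y = k by have := gxy Dxy; rewrite gx => -[].
    rewrite gy (ltn_eqF (ltnSn k)).
    have := f2C y gy; rewrite inE => /andP[_ /allP]; apply.
    by apply: map_f; rewrite mem_filter inE Dxy ysP gx eqxx.
  have gy : (g y == k.+1) = false by apply/negbTE; have := gxy Dxy; lia.
  by rewrite gy; apply: f2D.
Qed.

End Levels.

(** * The Ramsey bound *)

Lemma ramsey_upper (V : finType) (D : rel V) d q :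
    graded D -> 0 < d -> 0 < q -> 0 < #|V| ->
    (forall x, #|[set y | D y x]| <= d) -> (forall x, #|[set y | D x y]| <= q) ->
  exists2 N, unavoidable D N & N <= 8 ^ 5 * q * d ^ 2 * 2 ^ (4 * d) * #|V|.
Proof.
move=> /graded_compress[g [g_bd gD]] d0 q0 V0 D_in D_out.
exists (\sum_(k < #|V|.+1) span g d q k); last exact: sum_span.
set N := \sum_(k < _) _ => T /median_order[s [s_inj median]].
(* Relabelling along the median order turns its intervals into intervals of ['I_N]. *)
pose T' : rel 'I_N := fun i j => T (s i) (s j).
have g_gt0 v : 0 < g v by have /andP[] := g_bd v.
have [p [B [_ _ _ _ emb]]] :=
  @level_embedding V D g d q d0 q0 g_gt0 gD D_in D_out N T' median _ (leqnn N).
have [y _|f [_ _ f_inj fT]] := emb (fun=> B).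
  by split=> //; rewrite leq_pmull // sparsity_gt0.
have gV v : g v <= #|V| by have /andP[] := g_bd v.
exists (s \o f); split=> [x y /s_inj|x y]; last exact/fT/gV.
by apply: f_inj; rewrite inE gV.
Qed.

Lemma least_nat (P : nat -> Prop) n : P n ->
  exists m, [/\ P m, forall k, P k -> m <= k & m <= n].
Proof.
have [m le_nm] := ubnP n; elim: m n le_nm => // m IH n nm Pn.
have [[k Pk kn]|none] := classic (exists2 k, P k & k < n).
  have [|r [Pr r_min rk]] := IH k _ Pk; first exact: leq_trans kn _.
  by exists r; split=> //; apply: leq_trans rk (ltnW kn).
exists n; split=> // k Pk; rewrite leqNgt; apply/negP => kn.
by apply: none; exists k.
Qed.

Theorem theorem1p2 (V : finType) (D : rel V)
    (D_graded : graded D) (D_edge : 0 < max_degree D) :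
  exists r : nat,
    [/\ is_oriented_ramsey D r,
        r <= 10 ^ 9 * max_degree D ^ 3 * 2 ^ (4 * max_degree D) * #|V|
      & r <= 10 ^ 9 * max_outdegree D * max_indegree D ^ 2
               * 2 ^ (4 * max_indegree D) * #|V| ].
Proof.
have D_in x : #|[set y | D y x]| <= max_indegree D by apply: (leq_bigmax x).
have D_out x : #|[set y | D x y]| <= max_outdegree D by apply: (leq_bigmax x).
have [x [y Dxy]] : exists x y, D x y.
  apply: NNPP => none; move: D_edge; rewrite lt0n => /eqP; apply.
  apply: big1 => x _; apply: eq_card0 => y; rewrite inE.
  by apply/negP => /orP[] Dxy; apply: none; [exists x, y | exists y, x].
have V0 : 0 < #|V| by apply/card_gt0P; exists x.
have in_gt0 : 0 < max_indegree D.
  by apply: leq_trans (D_in y); apply/card_gt0P; exists x; rewrite inE.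
have out_gt0 : 0 < max_outdegree D.
  by apply: leq_trans (D_out x); apply/card_gt0P; exists y; rewrite inE.
have le_deg (R : rel V) : subrel R (fun x y => D x y || D y x) ->
    \max_x #|[set y | R x y]| <= max_degree D.
  move=> RD; apply/bigmax_leqP => z _; apply: leq_trans (leq_bigmax z).
  by apply/subset_leq_card/subsetP => u; rewrite !inE; apply: RD.
have in_le : max_indegree D <= max_degree D.
  by apply: (le_deg (fun x y => D y x)) => u v /= ->; rewrite orbT.
have out_le : max_outdegree D <= max_degree D by apply: le_deg => u v /= ->.
have [N un_N leN] := ramsey_upper D_graded in_gt0 out_gt0 V0 D_in D_out.
have [r [un_r r_min rN]] := least_nat un_N.
have const : 8 ^ 5 <= 10 ^ 9.
  by apply: (@leq_trans (10 ^ 5)); rewrite ?leq_exp2r ?leq_exp2l.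
have bound : r <= 10 ^ 9 * max_outdegree D * max_indegree D ^ 2
               * 2 ^ (4 * max_indegree D) * #|V|.
  by apply: leq_trans rN (leq_trans leN _); rewrite !leq_mul2r const !orbT.
exists r; split=> //; apply: leq_trans bound _.
rewrite leq_mul2r; apply/orP; right.
rewrite -[10 ^ 9 * _ * _]mulnA; apply: leq_mul; last by rewrite leq_exp2l // leq_mul2l in_le orbT.
by rewrite leq_mul2l (expnS _ 2) leq_mul ?orbT // leq_exp2r.
Qed.
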